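(* Let $B$ and $\widetilde{B}$ be bouquets and suppose there is a bijection $E(B)\to E(\widetilde{B})$ under which the intersection graphs $G_{D(B)}$ and $G_{D(\widetilde{B})}$ coincide. Then ${}^{\partial}\varepsilon_{B}(z)={}^{\partial}\varepsilon_{\widetilde{B}}(z)$.
   Context: A bouquet is a ribbon graph with exactly one vertex. For a ribbon graph $G$, $D(G)=(E(G),\mathcal{F})$ with $\mathcal{F}$ the edge sets of spanning quasi-trees of $G$ (spanning ribbon subgraphs with one boundary component per connected component); for a bouquet this delta-matroid is normal (contains $\emptyset$) and binary. $G^{A}$ is the partial dual of $G$ with respect to $A\subseteq E(G)$, $\varepsilon$ is Euler genus, and ${}^{\partial}\varepsilon_{G}(z)=\sum_{A\subseteq E(G)}z^{\varepsilon(G^{A})}$ is the partial duality polynomial. For a symmetric matrix $C$ over $GF(2)$ indexed by $E$, $D(C)=(E,\{A: C[A]\text{ nonsingular}\})$ with $C[\emptyset]$ nonsingular by convention; a normal binary delta-matroid $D$ equals $D(C)$ for a unique such $C$, and its intersection graph $G_D$ has vertex set $E$, distinct $u,v$ adjacent iff $C_{u,v}=1$, and a loop at $v$ iff $C_{v,v}=1$. *)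

(* Defs.v *)
(* Ribbon graphs are encoded by graph-encoded maps (gems):
   flags of an edge e are (e, a, b) : E * bool * bool; the canonical
   involutions tau0 (change vertex-side) and tau2 (change face-side) act
   within an edge, and a ribbon graph is given by a fixed-point-free
   involution t1 (change edge, keep vertex and face), plus a number of
   isolated (edgeless) vertices, which have no flags. *)
From HB Require Import structures.
From mathcomp Require Import all_boot all_order all_algebra.
Set Implicit Arguments. Unset Strict Implicit. Unset Printing Implicit Defensive.
Import GRing.Theory.
Local Open Scope ring_scope.

Notation flag E := (E * bool * bool)%type.

Definition fedge (E : finType) (x : flag E) : E := x.1.1.

Definition tau0 (E : finType) (x : flag E) : flag E := (x.1.1, ~~ x.1.2, x.2).
Definition tau2 (E : finType) (x : flag E) : flag E := (x.1.1, x.1.2, ~~ x.2).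

(* A ribbon graph (possibly non-orientable, possibly disconnected). *)
Record ribbon_graph := RibbonGraph {
  rg_E : finType;
  rg_t1 : flag rg_E -> flag rg_E;
  rg_t1_inv : involutive rg_t1;
  rg_t1_fpf : forall x, rg_t1 x != x;
  rg_iso : nat
}.
Arguments rg_t1 : clear implicits.

Record gem (E : finType) := Gem {
  g0 : flag E -> flag E; g1 : flag E -> flag E; g2 : flag E -> flag E;
  giso : nat }.

Definition nclasses (T : finType) (r : rel T) (P : pred T) : nat :=
  #|[set [set y | connect r x y] | x : T & P x]|.

Definition rel2 (T : finType) (f g : T -> T) : rel T :=
  fun x y => [|| y == f x, y == g x, x == f y | x == g y].
Definition rel3 (T : finType) (f g h : T -> T) : rel T :=
  fun x y => rel2 f g x y || (y == h x) || (x == h y).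

(* vertices = <g1,g2>-orbits, faces = <g0,g1>-orbits,
   components = <g0,g1,g2>-orbits; isolated vertices add 1 to each. *)
Definition gem_v E (G : gem E) : nat := nclasses (rel2 (g1 G) (g2 G)) predT + giso G.
Definition gem_f E (G : gem E) : nat := nclasses (rel2 (g0 G) (g1 G)) predT + giso G.
Definition gem_k E (G : gem E) : nat :=
  nclasses (rel3 (g0 G) (g1 G) (g2 G)) predT + giso G.
Definition gem_e E (G : gem E) : nat := #|E|.

(* Euler genus  2k - v + e - f  (always nonnegative) *)
Definition euler_genus E (G : gem E) : nat :=
  (2 * gem_k G + gem_e G - (gem_v G + gem_f G))%N.

Definition gem_of (G : ribbon_graph) : gem (rg_E G) :=
  Gem (@tau0 _) (rg_t1 G) (@tau2 _) (rg_iso G).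
Arguments gem_of : clear implicits.

Definition pdual (G : ribbon_graph) (A : {set rg_E G}) : gem (rg_E G) :=
  Gem (fun x => if fedge x \in A then tau2 x else tau0 x)
      (rg_t1 G)
      (fun x => if fedge x \in A then tau0 x else tau2 x)
      (rg_iso G).

Definition vertices (G : ribbon_graph) : nat := gem_v (gem_of G).

Definition bouquet (G : ribbon_graph) : Prop := vertices G = 1%N.

Definition pd_poly (G : ribbon_graph) : {poly int} :=
  \sum_(A : {set rg_E G}) 'X^(euler_genus (pdual A)).

Section Sub.
Variable G : ribbon_graph.
Local Notation E := (rg_E G).
Local Notation t1 := (rg_t1 G).
Variable A : {set E}.

Definition inA (x : flag E) : bool := fedge x \in A.

(* the edge-involution of the subgraph: walk around the vertex, skipping
   the flags of deleted edges *)
Definition reroute (x : flag E) : flag E :=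
  let s := [seq iter k (fun y => t1 (tau2 y)) (t1 x) | k <- iota 0 #|{: flag E}|] in
  nth x s (find inA s).

Definition rsub (r : rel (flag E)) : rel (flag E) :=
  fun x y => [&& inA x, inA y & r x y].

(* vertices of G none of whose flags survive become isolated vertices *)
Definition new_iso : nat :=
  #|[set [set y | connect (rel2 t1 (@tau2 E)) x y] | x : flag E &
      [forall y, connect (rel2 t1 (@tau2 E)) x y ==> ~~ inA y]]|.

Definition sub_faces : nat :=
  nclasses (rsub (rel2 (@tau0 E) reroute)) inA + new_iso + rg_iso G.
Definition sub_comps : nat :=
  nclasses (rsub (rel3 (@tau0 E) reroute (@tau2 E))) inA + new_iso + rg_iso G.

Definition quasi_tree : bool := sub_faces == sub_comps.
End Sub.

Definition Dfeas (G : ribbon_graph) : {set {set rg_E G}} :=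
  [set A | quasi_tree A].

Definition principal_nonsing (E : finType) (C : E -> E -> 'F_2) (A : {set E}) : bool :=
  \det (\matrix_(i < #|A|, j < #|A|) C (enum_val i) (enum_val j)) != 0.

Definition represents (E : finType) (F : {set {set E}}) (C : E -> E -> 'F_2) : Prop :=
  (forall u v, C u v = C v u) /\ F = [set A | principal_nonsing C A].

Definition ig_adj (E : finType) (C : E -> E -> 'F_2) (u v : E) : bool :=
  (u != v) && (C u v == 1).
Definition ig_loop (E : finType) (C : E -> E -> 'F_2) (v : E) : bool :=
  C v v == 1.

(* Main.v *)
(* Let f(A) be the number of boundary components of the spanning subgraph of a bouquet with edge set A. The partial dual by A has f(A) vertices and f(E \ A) faces, so its Euler genus is 2 + |E| - f(A) - f(E \ A). Toggling one edge in A changes f(A) by at most 1, and if f(A) > 1 then some edge meets two boundary components, which toggling it merges. Hence f(A) - 1 is the distance |A symdiff F| from A to the nearest quasi-tree F, so f, and with it the partial duality polynomial, depends only on the delta-matroid; the latter is determined by the intersection graph through C. *)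
Require Import Defs.
From HB Require Import structures.
From mathcomp Require Import all_boot all_order all_algebra.
From mathcomp Require Import perm zify.
Set Implicit Arguments. Unset Strict Implicit. Unset Printing Implicit Defensive.
Import GRing.Theory.

(** * Counting connectivity classes *)

Section Classes.
Variable T : finType.
Implicit Types (r : rel T) (P : pred T) (f g h : T -> T).

Definition class_of r x := [set y | connect r x y].

Lemma class_of_eq r x y :
  symmetric r -> (class_of r x == class_of r y) = connect r x y.
Proof.
move=> /sym_connect_sym rC; apply/eqP/idP => [E|xy].
  have : y \in class_of r y by rewrite inE.
  by rewrite -E inE.
by apply/setP=> z; rewrite !inE (same_connect rC xy).
Qed.

Lemma nclassesE r P : nclasses r P = #|class_of r @: [set x | P x]|.
Proof. by []. Qed.

(** Sending an [r']-class to the [r]-class of a point of [P] in it does not depend on the point, and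
    reaches every [r]-class that meets [P]. *)
Lemma leq_nclasses r r' P P' : symmetric r -> symmetric r' ->
  {in P &, forall x y, connect r' x y -> connect r x y} -> subpred P P' ->
  nclasses r P <= nclasses r' P'.
Proof.
move=> rS rS' sub PP'; rewrite !nclassesE.
pose phi (S : {set T}) :=
  if [pick x | P x && (class_of r' x == S)] is Some x then class_of r x else S.
apply: leq_trans (leq_imset_card phi _).
apply/subset_leq_card/subsetP=> _ /imsetP[x Px ->].
apply/imsetP; exists (class_of r' x).
  by rewrite imset_f // inE PP' //; rewrite inE in Px.
rewrite /phi; case: pickP => [y /andP[Py]|/(_ x)]; last first.
  by rewrite inE in Px; rewrite Px eqxx.
rewrite class_of_eq // => yx; apply/eqP; rewrite eq_sym class_of_eq //.
by rewrite inE in Px; apply: sub yx.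
Qed.

Lemma eq_nclasses r r' P : symmetric r -> symmetric r' ->
  {in P &, connect r =2 connect r'} -> nclasses r P = nclasses r' P.
Proof.
move=> rS rS' E; apply/eqP; rewrite eqn_leq; apply/andP; split;
  apply: leq_nclasses => // x y Px Py; by rewrite E.
Qed.

Lemma nclasses_gt0 r P : (0 < nclasses r P) = [exists x, P x].
Proof.
rewrite nclassesE card_gt0; apply/set0Pn/existsP => [[_ /imsetP[x xP _]]|[x xP]].
  by exists x; rewrite inE in xP.
by exists (class_of r x); rewrite imset_f ?inE.
Qed.

Lemma nclasses_split r P : symmetric r ->
  nclasses r predT = nclasses r P +
    #|class_of r @: [set x | [forall y, connect r x y ==> ~~ P y]]|.
Proof.
move=> rS; rewrite !nclassesE -cardsUI.
set X := [set x | P x]; set Y := [set x | [forall y, _]].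
have -> : class_of r @: X :&: class_of r @: Y = set0.
  apply/setP=> S; rewrite !inE; apply/negP=> /andP[/imsetP[x + ->]] /imsetP[y].
  rewrite !inE => xP /forallP/(_ x) + /eqP; rewrite xP implybF class_of_eq //.
  by rewrite (sym_connect_sym rS) => /negPf ->.
rewrite cards0 addn0; apply: eq_card => S; rewrite !inE.
apply/imsetP/orP=> [[x _ ->]|[]/imsetP[x _ ->]]; try by exists x; rewrite ?inE.
have [xY|] := boolP (x \in Y); first by right; apply: imset_f.
rewrite inE negb_forall => /existsP[y]; rewrite negb_imply negbK => /andP[xy Py].
left; apply/imsetP; exists y; first by rewrite inE.
by apply/eqP; rewrite class_of_eq.
Qed.

Lemma nclasses_remove r p : symmetric r ->
  nclasses r predT = (nclasses r (fun x => ~~ connect r p x)).+1.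
Proof.
move=> rS; rewrite !nclassesE.
rewrite (cardsD1 (class_of r p)) imset_f // add1n; congr _.+1.
apply: eq_card => S; rewrite !inE; apply/andP/imsetP.
  case=> nS /imsetP[x _ E]; exists x => //.
  by rewrite inE -class_of_eq // -E eq_sym.
case=> x; rewrite inE => px ->; rewrite imset_f // eq_sym class_of_eq //.
Qed.

Lemma rel2_sym f g : symmetric (rel2 f g).
Proof.
move=> x y; rewrite /rel2.
by case: (y == f x); case: (y == g x); case: (x == f y); case: (x == g y).
Qed.

Lemma rel3_sym f g h : symmetric (rel3 f g h).
Proof.
move=> x y; rewrite /rel3 rel2_sym.
by case: (rel2 f g y x); case: (y == h x); case: (x == h y).
Qed.

Lemma connect_rel2l f g x : connect (rel2 f g) x (f x).
Proof. by apply: connect1; rewrite /rel2 eqxx. Qed.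

Lemma connect_rel2r f g x : connect (rel2 f g) x (g x).
Proof. by apply: connect1; rewrite /rel2 eqxx orbT. Qed.

Lemma connect_rel2_sub f g r : symmetric r ->
  (forall x, connect r x (f x)) -> (forall x, connect r x (g x)) ->
  subrel (connect (rel2 f g)) (connect r).
Proof.
move=> /sym_connect_sym rC cf cg; apply: connect_sub => x y.
by case/or4P=> /eqP ->; rewrite // rC.
Qed.

(** [f] matches the elements of [S] in pairs, which the induction removes. *)
Lemma even_card_involution f (S : {set T}) :
  {in S, involutive f} -> {in S, forall x, f x != x} ->
  {in S, forall x, f x \in S} -> ~~ odd #|S|.
Proof.
have [n] := ubnP #|S|; elim: n S => // n IH S Sn fK ff fS.
have [->|[x xS]] := set_0Vmem S; first by rewrite cards0.
have fxS : f x \in S :\ x by rewrite !inE ff // fS.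
rewrite (cardsD1 x) xS (cardsD1 (f x)) fxS /= negbK.
apply: IH.
- by move: Sn; rewrite (cardsD1 x) xS (cardsD1 (f x)) fxS; lia.
- by move=> y; rewrite !inE => /and3P[_ _]; apply: fK.
- by move=> y; rewrite !inE => /and3P[_ _]; apply: ff.
move=> y; rewrite !inE => /and3P[yfx yx yS]; rewrite fS // andbT.
apply/andP; split; first by apply: contra yx => /eqP E; rewrite -(fK y yS) E fK.
by apply: contra yfx => /eqP <-; rewrite fK.
Qed.

End Classes.

(** * Boundary components and the toggling of an edge *)

Definition symdiff (E : finType) (A F : {set E}) : {set E} :=
  [set x | (x \in A) (+) (x \in F)].

Section Boundary.
Variable G : ribbon_graph.
Local Notation E := (rg_E G).
Local Notation t1 := (rg_t1 G).
Implicit Types (A F : {set E}) (e : E) (x y : flag E).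

Definition bd_inv A x : flag E := if fedge x \in A then tau0 x else tau2 x.

(* The number of boundary components of the spanning ribbon subgraph (V, A), which is also the number of vertices of the partial dual by A. *)
Definition nbd A : nat := nclasses (rel2 t1 (bd_inv A)) predT + rg_iso G.

Lemma tau0K : involutive (@tau0 E).
Proof. by case=> [[e a] b]; rewrite /tau0 /= negbK. Qed.

Lemma tau2K : involutive (@tau2 E).
Proof. by case=> [[e a] b]; rewrite /tau2 /= negbK. Qed.

Lemma fedge_bd_inv A x : fedge (bd_inv A x) = fedge x.
Proof. by rewrite /bd_inv; case: ifP. Qed.

Lemma bd_invK A : involutive (bd_inv A).
Proof.
move=> x; rewrite {1}/bd_inv fedge_bd_inv /bd_inv.
by case: (fedge x \in A); rewrite ?tau0K ?tau2K.
Qed.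

Lemma bd_inv_neq A x : bd_inv A x != x.
Proof.
case: x => [[e a] b]; rewrite /bd_inv /tau0 /tau2 /=.
by case: ifP => _; rewrite !xpair_eqE; case: a; case: b; rewrite ?andbF.
Qed.

Definition toggle A e := symdiff A [set e].

Lemma bd_inv_toggle A e x : fedge x != e -> bd_inv (toggle A e) x = bd_inv A x.
Proof. by move=> /negPf xe; rewrite /bd_inv !inE xe addbF. Qed.

(** The opposite flags [(e, false, false)] and [(e, true, true)] are exchanged by neither [tau0] nor
    [tau2], so they represent the two boundary arcs at [e] whether or not [e] is in [A]. *)
Lemma edge_flags A e x : fedge x = e ->
  [|| x == (e, false, false), x == bd_inv A (e, false, false),
      x == (e, true, true) | x == bd_inv A (e, true, true)].
Proof.
case: x => [[e' a] b]; rewrite /fedge /= => ->; rewrite /bd_inv /tau0 /tau2 /=.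
by case: ifP => _; case: a; case: b; rewrite !eqxx ?orbT.
Qed.

Lemma bd_inv_toggle00 A e :
  bd_inv (toggle A e) (e, false, false) = bd_inv A (e, true, true).
Proof. by rewrite /bd_inv /tau0 /tau2 /= !inE eqxx; case: (e \in A). Qed.

Lemma bd_connectC A : connect_sym (rel2 t1 (bd_inv A)).
Proof. exact/sym_connect_sym/rel2_sym. Qed.

(** Only the components of [p] and [q] pass along [e]. Once that of [p] is set aside, the remaining
    ones stay separated after the toggle. *)
Lemma nbd_toggle A e : nbd A <= (nbd (toggle A e)).+1.
Proof.
rewrite /nbd -addSn leq_add2r.
set p : flag E := (e, false, false); set q : flag E := (e, true, true).
rewrite (@nclasses_remove _ _ p) ?ltnS; last exact: rel2_sym.
apply: leq_nclasses => // [||x y px py xy]; try exact: rel2_sym.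
pose r := rel2 t1 (bd_inv A).
have rC : connect_sym r := bd_connectC A.
have touch z : fedge z = e -> connect r p z || connect r q z.
  case/(edge_flags A)/or4P=> /eqP ->; rewrite ?connect0 ?connect_rel2r ?orbT //.
have key : connect r x y || (connect r q x && connect r q y).
  (* Induction along the path: a step that does not stay within a component of [r] joins two flags
     of [e], hence stays in the components of [p] and [q]. *)
  have main: forall z, connect (rel2 t1 (bd_inv (toggle A e))) x z ->
    connect r x z || ((connect r p x || connect r q x) && (connect r p z || connect r q z)).
    move=> z /connectP[s sP ->] {z}.
    elim/last_ind: s sP => [|s w IH]; first by rewrite connect0.
    rewrite rcons_path last_rcons => /andP[/IH{IH}].
    set z := last x s => IH zw.
    have [zw'|tzw] : connect r z w \/ (fedge z = e /\ fedge w = e).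
      case/or4P: zw => /eqP zw.
      - by left; rewrite zw connect_rel2l.
      - have [ze|ze] := eqVneq (fedge z) e.
          by right; rewrite zw fedge_bd_inv.
        by left; rewrite zw bd_inv_toggle // connect_rel2r.
      - by left; rewrite zw rC connect_rel2l.
      have [ze|ze] := eqVneq (fedge w) e.
        by right; rewrite zw fedge_bd_inv.
      by left; rewrite zw bd_inv_toggle // rC connect_rel2r.
    - by rewrite !(same_connect_r rC zw') in IH *.
    case: tzw => /touch tz /touch tw; rewrite tw andbT tz andbT in IH *.
    case/orP: IH => [xz|->]; last by rewrite orbT.
    by rewrite !(same_connect_r rC xz) tz orbT.
  by have := main _ xy; rewrite (negPf px) (negPf py).
case/orP: key => // /andP[qx qy].
by rewrite -/r rC in qx; apply: connect_trans qx qy.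
Qed.

(* Deleting the two [bd_inv A]-edges at [e] leaves a graph whose vertices of odd degree are exactly the flags of [e]; so a component contains an even number of them. *)
Lemma connect_toggle A e p : fedge p = e ->
  (forall x, fedge x = e -> connect (rel2 t1 (bd_inv A)) p x ->
     x = p \/ x = bd_inv A p) ->
  connect (rel2 t1 (bd_inv (toggle A e))) p (bd_inv A p).
Proof.
move=> pe only.
(* Fixing the flags of [e] drops its arcs, so the orbits lie inside those of both [A] and
   [toggle A e]. *)
pose k x := if fedge x == e then x else bd_inv A x.
have kA : subrel (connect (rel2 t1 k)) (connect (rel2 t1 (bd_inv A))).
  apply: connect_rel2_sub => [|x|x]; [exact: rel2_sym|exact: connect_rel2l|].
  by rewrite /k; case: ifP => _; rewrite ?connect0 ?connect_rel2r.
have kT : subrel (connect (rel2 t1 k)) (connect (rel2 t1 (bd_inv (toggle A e)))).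
  apply: connect_rel2_sub => [|x|x]; [exact: rel2_sym|exact: connect_rel2l|].
  rewrite /k; case: eqP => xe; rewrite ?connect0 //.
  by rewrite -(@bd_inv_toggle A e) ?connect_rel2r //; apply/eqP.
apply: kT; apply/negPn/negP => np.
pose S := class_of (rel2 t1 k) p.
have evS : ~~ odd #|S|.
  apply: (@even_card_involution _ t1) => x; rewrite ?inE => xS.
  - exact: rg_t1_inv.
  - exact: rg_t1_fpf.
  exact: connect_trans xS (connect_rel2l _ _ _).
(* With [bd_inv A p] outside [S], [only] leaves [p] as the sole flag of [e] in [S], so [bd_inv A]
   pairs off the rest. *)
have evS' : ~~ odd #|S :\ p|.
  apply: (@even_card_involution _ (bd_inv A)) => x; rewrite ?inE.
  - by move=> _; apply: bd_invK.
  - by move=> _; apply: bd_inv_neq.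
  case/andP=> xp xS.
  have xe : fedge x != e.
    apply/eqP=> /only/(_ (kA _ _ xS))[] E; first by rewrite E eqxx in xp.
    by rewrite -E xS in np.
  apply/andP; split; first by apply: contra xe => /eqP E; rewrite -(fedge_bd_inv A) E pe.
  apply: connect_trans xS _.
  have -> : bd_inv A x = k x by rewrite /k (negPf xe).
  exact: connect_rel2r.
by move: evS; rewrite (cardsD1 p) inE connect0 /= (negPf evS').
Qed.

(** When the two arcs lie on different components, [connect_toggle] keeps the ends of each arc
    joined and [bd_inv_toggle00] links the arcs, so connectivity only grows and two components
    become one. *)
Lemma nbd_merge A e :
  ~~ connect (rel2 t1 (bd_inv A)) (e, false, false) (e, true, true) ->
  nbd (toggle A e) < nbd A.
Proof.
set p : flag E := (e, false, false); set q : flag E := (e, true, true) => npq.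
pose r := rel2 t1 (bd_inv A); pose r' := rel2 t1 (bd_inv (toggle A e)).
have rC : connect_sym r := bd_connectC A.
have rC' : connect_sym r' := bd_connectC _.
have pp : connect r' p (bd_inv A p).
  apply: connect_toggle => // x /(edge_flags A)/or4P[]/eqP -> px; auto.
    by rewrite px in npq.
  by rewrite (same_connect_r rC (connect_rel2r t1 (bd_inv A) q)) in npq; rewrite px in npq.
have qq : connect r' q (bd_inv A q).
  apply: connect_toggle => // x /(edge_flags A)/or4P[]/eqP -> qx; auto; move: npq; rewrite -/r rC.
    by rewrite qx.
  by rewrite (same_connect_r rC (connect_rel2r t1 (bd_inv A) p)) qx.
have pq : connect r' p q.
  by rewrite (same_connect_r rC' qq) -bd_inv_toggle00 connect_rel2r.
have sub : subrel (connect r) (connect r').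
  apply: connect_rel2_sub => [|x|x]; [exact: rel2_sym|exact: connect_rel2l|].
  have [xe|xe] := eqVneq (fedge x) e; last first.
    by rewrite -(bd_inv_toggle _ xe) connect_rel2r.
  by case/or4P: (edge_flags A xe) => /eqP ->; rewrite ?bd_invK // rC'.
rewrite /nbd ltn_add2r (@nclasses_remove _ r p) ?ltnS; last exact: rel2_sym.
(* Dropping the [r]-class of [p] loses no [r']-class: [q] lies outside it and is [r']-connected to
   [p]. *)
have -> : nclasses r' predT = nclasses r' (fun x => ~~ connect r p x).
  rewrite !nclassesE; apply: eq_card => S; apply/imsetP/imsetP=> -[x xP ->]; last by exists x; rewrite ?inE.
  have [px|px] := boolP (connect r p x); last by exists x; rewrite ?inE.
  exists q; first by rewrite inE.
  apply/eqP; rewrite class_of_eq; last exact: rel2_sym.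
  by apply: connect_trans pq; rewrite rC'; apply: sub.
apply: leq_nclasses => // [||x y _ _]; try exact: rel2_sym.
exact: sub.
Qed.

(** * Rerouting around deleted edges *)

Section Reroute.
Variables (A : {set E}) (g : flag E -> flag E).
Hypotheses (gK : involutive g) (fedge_g : forall x, fedge (g x) = fedge x).

(** For [g] equal to [tau0] this is [bd_inv A] and yields boundary components; for [tau2] it is
    [tau2] everywhere and yields vertices. *)
Let h x := if inA A x then g x else tau2 x.

Let inA_h x : inA A (h x) = inA A x.
Proof. by rewrite /h; case: ifP => xA; rewrite /inA ?fedge_g. Qed.

Let hK : involutive h.
Proof.
move=> x; rewrite {1}/h inA_h /h.
by case: (inA A x); rewrite ?gK ?tau2K.
Qed.

Let walk x k := iter k (fun y => t1 (tau2 y)) (t1 x).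

(** Iterating the injective map [t1 (tau2 y)] from [tau2 x] returns to [tau2 x], a flag of [A],
    within the length of the list. So [find] succeeds and the default of [nth] is not taken. *)
Lemma rerouteP x : inA A x ->
  exists k, [/\ reroute A x = walk x k, inA A (walk x k) &
    forall i, i < k -> ~~ inA A (walk x i)].
Proof.
move=> xA; rewrite /reroute.
set n := #|_|; rewrite -/(mkseq (walk x) n).
have walk_inj : injective (fun y => t1 (tau2 y)).
  exact: inj_comp (can_inj (rg_t1_inv (r := G))) (can_inj tau2K).
have walkE k : walk x k = iter k.+1 (fun y => t1 (tau2 y)) (tau2 x).
  by rewrite iterSr /= tau2K.
have hasA : has (inA A) (mkseq (walk x) n).
  apply/hasP; exists (tau2 x) => //.
  apply/mapP; exists (order (fun y => t1 (tau2 y)) (tau2 x)).-1.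
    by rewrite mem_iota add0n prednK ?order_gt0 //; apply: max_card.
  by rewrite walkE prednK ?order_gt0 // iter_order.
have findn : find (inA A) (mkseq (walk x) n) < n by move: hasA; rewrite has_find size_mkseq.
exists (find (inA A) (mkseq (walk x) n)); split.
- by rewrite nth_mkseq.
- by have := nth_find x hasA; rewrite nth_mkseq.
move=> i lt; have := before_find x lt; rewrite nth_mkseq => [->|] //.
exact: ltn_trans findn.
Qed.

(** [reroute] shortcuts a walk through deleted flags, where [h] is [tau2]; conversely, an invariant
    along a path recovers the shortcuts. *)
Lemma connect_rsub_reroute x y : inA A x -> inA A y ->
  connect (rel2 t1 h) x y = connect (rsub A (rel2 g (reroute A))) x y.
Proof.
have rC : connect_sym (rel2 t1 h) by apply/sym_connect_sym/rel2_sym.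
have rerouteE z k : inA A z -> inA A (walk z k) ->
    (forall i, i < k -> ~~ inA A (walk z i)) -> reroute A z = walk z k.
  move=> zA kA before; have [k' [-> k'A before']] := rerouteP zA.
  case: (ltngtP k k') => [/before'|/before|-> //]; first by rewrite kA.
  by rewrite k'A.
have c_reroute z : inA A z -> connect (rel2 t1 h) z (reroute A z).
  case/rerouteP=> k [-> _]; elim: k => [|k IH] lt; first exact: connect_rel2l.
  apply: connect_trans (IH _) _ => [i ik|]; first by apply: lt; apply: ltnW.
  apply: connect_trans (connect_rel2l _ _ _).
  have -> : tau2 (walk z k) = h (walk z k) by rewrite /h (negPf (lt k _)).
  exact: connect_rel2r.
move=> xA yA; apply/idP/idP; last first.
  apply: connect_sub => {x y xA yA} x y /and3P[xA yA].
  have c_g z : inA A z -> connect (rel2 t1 h) z (g z).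
    by move=> zA; have := connect_rel2r t1 h z; rewrite {2}/h zA.
  by case/or4P=> /eqP ->; rewrite ?c_reroute ?c_g // rC ?c_reroute ?c_g.
(* Along the walk from [x], remember the last flag [a] of [A] that was met and how far the walk has gone around the vertex since then. *)
pose inv z := exists2 a, inA A a && connect (rsub A (rel2 g (reroute A))) x a &
  z = a \/ exists k, (forall i, i < k -> ~~ inA A (walk a i)) /\
    (z = walk a k \/ ~~ inA A (walk a k) /\ z = tau2 (walk a k)).
have inv_t1 z : inv z -> inv (t1 z).
  case=> a ax [->|[k [before [->|[kA ->]]]]].
  - by exists a => //; right; exists 0; split=> //; left.
  - exists a => //; case: k before => [|k] before; first by left; apply: rg_t1_inv.
    right; exists k; split; first by move=> i ik; apply: before; apply: ltnW.
    by right; split; [apply: before|apply: rg_t1_inv].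
  exists a => //; right; exists k.+1; split; last by left.
  by move=> i; rewrite ltnS leq_eqVlt => /orP[/eqP ->|/before].
have inv_h z : inv z -> inv (h z).
  have inA_inv a : inA A a -> connect (rsub A (rel2 g (reroute A))) x a -> inv (h a).
    move=> aA xa; exists (g a); last by left; rewrite /h aA.
    rewrite {1}/inA fedge_g -/(inA A a) aA; apply: connect_trans xa (connect1 _).
    by rewrite /rsub /rel2 aA /inA fedge_g -/(inA A a) aA eqxx.
  case=> a /andP[aA xa] [->|[k [before [->|[kA ->]]]]]; first exact: inA_inv.
    (* If in [A], this is the first such flag met after [a], hence [reroute A a], and [h] continues
       from it. *)
    have [kA|kA] := boolP (inA A (walk a k)).
      apply: inA_inv => //; apply: connect_trans xa (connect1 _).
      by rewrite /rsub /rel2 aA kA (rerouteE a k) // eqxx orbT.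
    exists a; first by rewrite aA.
    by right; exists k; split=> //; right; rewrite /h (negPf kA).
  exists a; first by rewrite aA.
  right; exists k; split=> //; left.
  by rewrite /h /inA /= -/(inA A (walk a k)) (negPf kA) tau2K.
move: yA => /[swap] /connectP[s sP ->{y}] yA.
have : inv (last x s).
  elim/last_ind: s sP {yA} => [|s w IH]; first by exists x => /=; [rewrite xA connect0|left].
  rewrite rcons_path last_rcons => /andP[/IH{IH}].
  set z := last x s => IH /or4P[]/eqP zw.
  - by rewrite zw; apply: inv_t1.
  - by rewrite zw; apply: inv_h.
  - by rewrite -(rg_t1_inv w) -zw; apply: inv_t1.
  by rewrite -(hK w) -zw; apply: inv_h.
case=> a /andP[aA xa] [-> //|[k [before [E|[kA E]]]]]; rewrite E in yA *; last first.
  by move: yA; rewrite /inA /= -/(inA A (walk a k)) (negPf kA).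
apply: connect_trans xa (connect1 _).
by rewrite /rsub /rel2 aA yA (rerouteE a k) // eqxx orbT.
Qed.

Lemma rsub_sym (r : rel (flag E)) : symmetric r -> symmetric (rsub A r).
Proof. by move=> rS x y; rewrite /rsub rS andbCA. Qed.

(** Orbits meeting [A] correspond to rerouted ones; on the others [h] is [tau2], so they are the
    vertices counted by [new_iso]. *)
Lemma nclasses_reroute :
  nclasses (rsub A (rel2 g (reroute A))) (inA A) + new_iso A =
  nclasses (rel2 t1 h) predT.
Proof.
rewrite (nclasses_split (inA A)); last exact: rel2_sym.
congr (_ + _).
  apply: eq_nclasses => [||x y xA yA]; [exact/rsub_sym/rel2_sym|exact: rel2_sym|].
  by rewrite connect_rsub_reroute.
(* Stated for general [u] and [u'] so as to serve both inclusions between [h]-orbits and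
   [tau2]-orbits. *)
have avoid (u u' : flag E -> flag E) x :
    (forall y, inA A (u' y) = inA A y) ->
    (forall y, ~~ inA A y -> u y = u' y) ->
    [forall y, connect (rel2 t1 u) x y ==> ~~ inA A y] ->
    subpred (connect (rel2 t1 u') x) (connect (rel2 t1 u) x).
  move=> u'A uu' /forallP av y /connectP[s sP ->{y}].
  have rC : connect_sym (rel2 t1 u) by apply/sym_connect_sym/rel2_sym.
  elim/last_ind: s sP => [|s w IH]; first by rewrite connect0.
  rewrite rcons_path last_rcons => /andP[/IH{IH}].
  set z := last x s => xz zw.
  have zA : ~~ inA A z by have := av z; rewrite xz.
  apply: connect_trans xz _.
  case/or4P: zw => /eqP zw.
  - by rewrite zw connect_rel2l.
  - by rewrite zw -uu' // connect_rel2r.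
  - by rewrite zw rC connect_rel2l.
  by rewrite zw u'A in zA; rewrite rC zw -uu' // connect_rel2r.
have inA_tau2 y : inA A (tau2 y) = inA A y by [].
have htau2 y : ~~ inA A y -> h y = tau2 y by rewrite /h => /negPf ->.
have tau2h y : ~~ inA A y -> tau2 y = h y by move/htau2.
have subav u u' x : subpred (connect (rel2 t1 u') x) (connect (rel2 t1 u) x) ->
    [forall y, connect (rel2 t1 u) x y ==> ~~ inA A y] ->
    [forall y, connect (rel2 t1 u') x y ==> ~~ inA A y].
  move=> sub /forallP av; apply/forallP => y; apply/implyP=> /sub xy.
  by have := av y; rewrite xy.
rewrite /new_iso; apply: eq_card => S; apply/imsetP/imsetP=> -[x]; rewrite inE => av ->.
  have sub := avoid _ _ _ inA_h tau2h av.
  have av' := subav _ _ _ sub av.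
  exists x; first by rewrite inE.
  apply/setP=> y; rewrite !inE; apply/idP/idP; last exact: sub.
  exact: avoid av' _.
have sub := avoid _ _ _ inA_tau2 htau2 av.
have av' := subav _ _ _ sub av.
exists x; first by rewrite inE.
apply/setP=> y; rewrite !inE; apply/idP/idP; last exact: sub.
exact: avoid av' _.
Qed.

End Reroute.

Lemma sub_facesE A : sub_faces A = nbd A.
Proof. by rewrite /sub_faces nclasses_reroute //; exact: tau0K. Qed.

(** * Quasi-trees and Euler genus in a bouquet *)

Section Bouquet.
Hypothesis bouquetG : bouquet G.

(** Such a relation is coarser than the vertex relation, which has one class, unless there are no
    flags and [rg_iso G] is 1. *)
Lemma bouquet_nclasses (r : rel (flag E)) : symmetric r ->
  (forall x, connect r x (t1 x)) -> (forall x, connect r x (tau2 x)) ->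
  nclasses r predT + rg_iso G = 1.
Proof.
move=> rS c1 c2; have := bouquetG; rewrite /bouquet /vertices /gem_v /=.
move mdef: (nclasses _ _) => m mE.
have le : nclasses r predT <= m.
  rewrite -mdef; apply: leq_nclasses => // [|x y _ _]; first exact: rel2_sym.
  exact: connect_rel2_sub.
have pos : (0 < nclasses r predT) = (0 < m) by rewrite -mdef !nclasses_gt0.
move: (nclasses r predT) le pos => n; lia.
Qed.

Lemma nbd_gt0 A : 0 < nbd A.
Proof.
have := bouquetG; rewrite /bouquet /vertices /gem_v /= /nbd => bq.
have : 0 < nclasses (rel2 t1 (@tau2 E)) predT + rg_iso G by rewrite bq.
by rewrite !addn_gt0 !nclasses_gt0.
Qed.

Lemma quasi_treeE A : quasi_tree A = (nbd A == 1).
Proof.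
rewrite /quasi_tree sub_facesE; congr (_ == _); rewrite /sub_comps.
(* Taking [tau2] for [g] counts the vertices of the subgraph: one, as in [G], so there is one
   component. *)
have := nclasses_reroute A tau2K (fun=> erefl).
have -> : nclasses (rel2 t1 (fun x => if inA A x then tau2 x else tau2 x)) predT =
    nclasses (rel2 t1 (@tau2 E)) predT.
  apply: eq_nclasses => [||x y _ _]; try exact: rel2_sym.
  by apply: eq_connect => {}x {}y; rewrite /rel2 !if_same.
move/(congr1 (addn^~ (rg_iso G))); rewrite [in RHS](bouquetG : _ + _ = 1).
set n := nclasses _ _; set m := nclasses _ _.
have le : m <= n.
  apply: leq_nclasses => //; try exact/rsub_sym/rel2_sym.
    exact/rsub_sym/rel3_sym.
  move=> x y _ _; apply: connect_sub => {}x {}y /and3P[xA yA xy].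
  apply: connect1; rewrite /rsub xA yA /rel3 /rel2 /=.
  by case/or4P: xy => ->; rewrite ?orbT.
have pos : (0 < m) = (0 < n) by rewrite !nclasses_gt0.
by move: n m le pos => n m; lia.
Qed.

(** If each edge had both arcs on one component, all [tau2] steps would stay within components, and
    [bouquet_nclasses] would leave just one. *)
Lemma nbd_decrease A : 1 < nbd A -> exists e, nbd (toggle A e) < nbd A.
Proof.
move=> gt1.
have [/existsP[e /nbd_merge]|] :=
  boolP [exists e, ~~ connect (rel2 t1 (bd_inv A)) (e, false, false) (e, true, true)].
  by exists e.
rewrite negb_exists => /forallP all_e; suff E1 : nbd A = 1 by rewrite E1 in gt1.
apply: bouquet_nclasses => [|x|x]; [exact: rel2_sym|exact: connect_rel2l|].
have rC := bd_connectC A.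
have toP y : connect (rel2 t1 (bd_inv A)) (fedge y, false, false) y.
  have := all_e (fedge y); rewrite negbK => pq.
  case/or4P: (edge_flags A (erefl (fedge y))) => /eqP {2}->;
    rewrite ?connect0 ?connect_rel2r //.
  exact: connect_trans pq (connect_rel2r _ _ _).
have := toP (tau2 x); rewrite /fedge /=; apply: connect_trans.
by rewrite rC; apply: toP.
Qed.

(** Forward, [nbd_decrease] is iterated; backward, the elements of the symmetric difference are
    toggled one by one, each costing at most one component. *)
Lemma nbd_leP A n :
  reflect (exists2 F, nbd F = 1 & #|symdiff F A| <= n) (nbd A <= n.+1).
Proof.
apply: (iffP idP) => [|[F]].
  elim: n A => [|n IH] A le.
    exists A; first by have := nbd_gt0 A; lia.
    by rewrite leqn0 cards_eq0; apply/eqP/setP=> x; rewrite !inE addbb.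
  have [gt1|le1] := ltnP 1 (nbd A); last first.
    exists A; first by have := nbd_gt0 A; lia.
    by rewrite (_ : symdiff A A = set0) ?cards0 //; apply/setP=> x; rewrite !inE addbb.
  have [e lt] := nbd_decrease gt1.
  have [|F F1 Fn] := IH (toggle A e); first by lia.
  exists F => //; apply: leq_trans (_ : #|e |: symdiff F (toggle A e)| <= _).
    apply/subset_leq_card/subsetP=> x; rewrite !inE.
    by case: eqP => //= _; rewrite addbF.
  by rewrite cardsU1; lia.
elim: n A => [|n IH] A F1.
  rewrite leqn0 cards_eq0 => /eqP E0; suff <- : F = A by rewrite F1.
  apply/setP=> x; have := in_set0 x; rewrite -E0 inE.
  by case: (x \in F); case: (x \in A).
have [E0 _|[e eS] le] := set_0Vmem (symdiff F A).
  by apply/leqW/IH; rewrite ?E0 ?cards0.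
apply: leq_trans (nbd_toggle A e) _; rewrite ltnS; apply: IH => //.
suff -> : symdiff F (toggle A e) = symdiff F A :\ e by move: le; rewrite (cardsD1 e) eS.
apply/setP=> x; rewrite !inE; have [->|_] := eqVneq; last by rewrite addbF.
by rewrite inE in eS; move: eS; case: (e \in F); case: (e \in A).
Qed.

Lemma euler_genus_pdual A :
  euler_genus (pdual A) = 2 + #|E| - (nbd A + nbd (~: A)).
Proof.
rewrite /euler_genus /gem_e /gem_v /gem_f /gem_k /=.
rewrite bouquet_nclasses => [||x|x]; first last.
- by apply: connect1; rewrite /rel3 /rel2 /=; case: (fedge x \in A); rewrite eqxx ?orbT.
- by apply: connect1; rewrite /rel3 /rel2 eqxx ?orbT.
- exact: rel3_sym.
(* The vertex count is [nbd A] by definition; faces use [tau2] on [A] and [tau0] off it, which is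
   [bd_inv (~: A)]. *)
congr (_ - (_ + (_ + _))); apply: eq_nclasses => [||x y _ _]; try exact: rel2_sym.
apply: eq_connect => {}x {}y; rewrite /rel2 /bd_inv !in_setC !if_neg.
by case: (y == t1 x); case: (x == t1 y); rewrite ?orbT ?orbF.
Qed.

End Bouquet.
End Boundary.

(** * Transport along a bijection of edges *)

Lemma imset_cancel (T T' : finType) (f : T -> T') (f' : T' -> T) :
  cancel f f' -> cancel (fun A : {set T} => f @: A) (fun A : {set T'} => f' @: A).
Proof. by move=> fK A; rewrite -imset_comp (eq_imset _ (fK : _ =1 id)) imset_id. Qed.

(** The image of a quasi-tree nearest to [A] is a quasi-tree at no greater distance from
    [f @: A]. *)
Lemma leq_nbd_imset (B B' : ribbon_graph) (f : rg_E B -> rg_E B')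
    (A : {set rg_E B}) :
  bouquet B -> bouquet B' -> injective f ->
  (forall F : {set rg_E B}, quasi_tree F -> quasi_tree (f @: F)) -> nbd (f @: A) <= nbd A.
Proof.
move=> bB bB' fI fq; have := nbd_gt0 bB A.
case En : (nbd A) => [|n] // _; apply/(nbd_leP bB').
have /(nbd_leP bB)[F F1 le] : nbd A <= n.+1 by rewrite En.
exists (f @: F); first by apply/eqP; rewrite -quasi_treeE // fq // quasi_treeE // F1.
apply: leq_trans le; apply: leq_trans (leq_imset_card f _).
apply/subset_leq_card/subsetP=> y; rewrite inE => yFA.
have [x E] : exists x, y = f x.
  have [/imsetP[x _ ->]|yF] := boolP (y \in f @: F); first by exists x.
  by move: yFA; rewrite (negPf yF) => /imsetP[x _ ->]; exists x.
by move: yFA; rewrite E !mem_imset // => xFA; rewrite inE.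
Qed.

(** The enumerations of [A] and [f @: A] differ by a permutation, which acts on rows and columns
    alike, so its signs cancel. *)
Lemma principal_nonsing_imset (E E' : finType) (f : E -> E') C C'
    (A : {set E}) :
  injective f -> (forall u v, C' (f u) (f v) = C u v) ->
  principal_nonsing C' (f @: A) = principal_nonsing C A.
Proof.
move=> fI fC; rewrite /principal_nonsing.
have fA (i : 'I_#|A|) : exists j : 'I_#|f @: A|, enum_val j == f (enum_val i).
  have fiA : f (enum_val i) \in f @: A by rewrite imset_f ?enum_valP.
  by exists (enum_rank_in fiA (f (enum_val i))); rewrite enum_rankK_in.
have [s sP] := fin_all_exists fA.
(* Generalizing the enumerations lets [#|f @: A|] be rewritten to [#|A|] in their types. *)
move: (@enum_val _ (mem A)) (@enum_val_inj _ (mem A)) (@enum_val _ (mem (f @: A))) s sP {fA}.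
rewrite /= card_imset // => u uI u' s sP.
have sI : injective s.
  by move=> i j sij; apply/uI/fI; rewrite -(eqP (sP i)) -(eqP (sP j)) sij.
set M' := (\matrix_(i, j) C' _ _)%R; set M := (\matrix_(i, j) C _ _)%R.
have -> : M = row_perm (perm sI) (col_perm (perm sI) M').
  by apply/matrixP=> i j; rewrite !mxE !permE (eqP (sP i)) (eqP (sP j)) fC.
rewrite row_permE col_permE !det_mulmx !det_perm odd_permV mulrC -mulrA.
by rewrite -signr_addb addbb mulr1.
Qed.

Lemma eq_F2 (x y : 'F_2) : (x == 1%R) = (y == 1%R) -> x = y.
Proof. by case: x => [[|[|[]]]] // ?; case: y => [[|[|[]]]] // ? _; apply: val_inj. Qed.

Lemma quasi_tree_imset (B B' : ribbon_graph) (f : rg_E B -> rg_E B') C C' :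
  injective f -> represents (Dfeas B) C -> represents (Dfeas B') C' ->
  (forall u v, C' (f u) (f v) = C u v) ->
  forall A : {set rg_E B}, quasi_tree (f @: A) = quasi_tree A.
Proof.
move=> fI [_ DC] [_ DC'] fC A.
have := principal_nonsing_imset A fI fC.
have /setP/(_ A) := DC; have /setP/(_ (f @: A)) := DC'.
by rewrite !inE => -> ->.
Qed.

Theorem mainTheorem4 (B B' : ribbon_graph) (f : rg_E B -> rg_E B') :
  bouquet B -> bouquet B' -> bijective f ->
  (exists (C : rg_E B -> rg_E B -> 'F_2) (C' : rg_E B' -> rg_E B' -> 'F_2),
      [/\ represents (Dfeas B) C, represents (Dfeas B') C',
          (forall u v, ig_adj C' (f u) (f v) = ig_adj C u v) &
          (forall v, ig_loop C' (f v) = ig_loop C v)]) ->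
  pd_poly B = pd_poly B'.
Proof.
move=> bB bB' fbij [C [C' [DC DC' adj loop]]].
have fI := bij_inj fbij; have [f' fK f'K] := fbij.
(* Loops determine the diagonal and adjacency the other entries. *)
have fC u v : C' (f u) (f v) = C u v.
  have [<-|uv] := eqVneq u v; first exact/eq_F2/loop.
  by apply: eq_F2; have := adj u v; rewrite /ig_adj (inj_eq fI) uv.
have imK := imset_cancel fK; have imK' := imset_cancel f'K.
have fq := quasi_tree_imset fI DC DC' fC.
have nbdE (A : {set rg_E B}) : nbd (f @: A) = nbd A.
  apply/eqP; rewrite eqn_leq leq_nbd_imset // => [|F]; last by rewrite fq.
  (* The reverse inequality is the same lemma for [f'], applied to [f @: A]. *)
  rewrite -{1}[A]imK leq_nbd_imset //; first exact: can_inj f'K.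
  by move=> F; rewrite -{1}[F]imK' fq.
rewrite /pd_poly [RHS](reindex (fun A : {set rg_E B} => f @: A)); last first.
  by apply: onW_bij; exists (fun A : {set rg_E B'} => f' @: A).
apply: eq_bigr => A _; rewrite !euler_genus_pdual // (bij_eq_card fbij).
suff -> : ~: (f @: A) = f @: ~: A by rewrite !nbdE.
by apply/setP=> y; rewrite -(f'K y) !(inE, mem_imset).
Qed.
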